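(* Let $n=p+q$ be a natural number, let $h^1,\dots,h^n:\mathbb{R}^{p,q}\to\mathcal{C}\ell(p,q)$ be a smooth Clifford field vector, $h_\rho=\eta_{\rho\mu}h^\mu$, and let $C_1,\dots,C_n:\mathbb{R}^{p,q}\to\mathcal{C}\ell_{\circledS}(p,q)$ be smooth. Put $n'=n$ if $n$ is even and $n'=n-1$ if $n$ is odd, and $\mu_k=\dfrac{1}{n-(-1)^k(n-2k)}$ for $1\le k\le n'$. Then the following are equivalent: (a) $\partial_\mu h_\rho-[C_\mu,h_\rho]=0$ for all $\mu,\rho=1,\dots,n$; (b) $C_\mu=\sum_{k=1}^{n'}\mu_k\,\pi[h]_k\big((\partial_\mu h^\rho)h_\rho\big)$ for all $\mu=1,\dots,n$ (summation over $\rho$).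
   Context: $\mathbb{R}^{p,q}$ is $\mathbb{R}^n$ with Cartesian coordinates $x^\mu$, $\partial_\mu=\partial/\partial x^\mu$, metric $\eta=(\eta_{\mu\nu})=(\eta^{\mu\nu})=\mathrm{diag}(1,\dots,1,-1,\dots,-1)$ ($p$ ones, $q$ minus ones); Einstein summation is used. $\mathcal{C}\ell(p,q)$ is the complex Clifford algebra with identity $e$ and generators $e^1,\dots,e^n$, $e^ae^b+e^be^a=2\eta^{ab}e$, with basis $e$, $e^{a_1\dots a_k}=e^{a_1}\cdots e^{a_k}$ ($a_1<\dots<a_k$); functions into it are differentiated coefficientwise. $[U,V]=UV-VU$. $\mathrm{Tr}(U)$ is the coefficient of $e$ in $U$. The center is spanned by $e$ for even $n$ and by $e$ and $e^{1\dots n}$ for odd $n$; $\mathcal{C}\ell_{\circledS}(p,q)$ is the set of elements with zero projection onto the center (w.r.t. the basis above). A Clifford field vector is a collection $h^\mu:\mathbb{R}^{p,q}\to\mathcal{C}\ell(p,q)$, $\mu=1,\dots,n$, with $h^\mu h^\nu+h^\nu h^\mu=2\eta^{\mu\nu}e$ and $\mathrm{Tr}(h^1\cdots h^n)=0$ at every point. At each point the elements $e$ and $h^{\nu_1}\cdots h^{\nu_k}$ ($1\le\nu_1<\dots<\nu_k\le n$, $k=1,\dots,n$) form a basis of $\mathcal{C}\ell(p,q)$ (the algebra of $h$-forms); for $k=0,\dots,n$, $\pi[h]_k$ denotes the projection onto the span of the products with exactly $k$ factors (the span of $e$ for $k=0$) with respect to this basis. *)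

(* Defs.v *)
From HB Require Import structures.
From mathcomp Require Import all_boot all_order all_algebra.
From mathcomp Require Import all_classical all_reals all_analysis.
From mathcomp Require Import complex.

Set Implicit Arguments.
Unset Strict Implicit.
Unset Printing Implicit Defensive.

Import Order.TTheory GRing.Theory Num.Theory.
Import numFieldNormedType.Exports.
Local Open Scope ring_scope.

Section Clifford.
Variable R : realType.
Variables p q : nat.
Local Notation n := (p + q)%N.
Local Notation C := (R[i]).

(** Elements of the complex Clifford algebra Cl(p,q): coordinates w.r.t. the
    basis e^A = e^{a_1}...e^{a_k} (a_1 < ... < a_k), A a subset of the
    generator indices 'I_n (index i : 'I_n stands for generator e^{i+1}). *)
Definition cl := {ffun {set 'I_n} -> C}.

Definition eta (a b : 'I_n) : C :=
  if a == b then (if (a < p)%N then 1 else -1) else 0.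

Definition cl_scale (c : C) (U : cl) : cl := [ffun A => c * U A].

Definition cl_basis (A : {set 'I_n}) : cl := [ffun B => if B == A then 1 else 0].

Definition cl_e : cl := cl_basis finset.set0.

Definition cl_gen (a : 'I_n) : cl := cl_basis [set a].

(** product of basis elements: e^A e^B = sign * (prod_{a in A cap B} eta^{aa}) e^{A xor B} *)
Definition basis_coef (A B : {set 'I_n}) : C :=
  (-1) ^+ #|[set ab : 'I_n * 'I_n | (ab.1 \in A) && (ab.2 \in B) && (ab.2 < ab.1)%N]|
  * \prod_(a in A :&: B) eta a a.

Definition symdiff (A B : {set 'I_n}) : {set 'I_n} := (A :\: B) :|: (B :\: A).

Definition cl_mul (U V : cl) : cl :=
  [ffun D => \sum_(A : {set 'I_n}) \sum_(B : {set 'I_n} | symdiff A B == D)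
                U A * V B * basis_coef A B].

Definition cl_comm (U V : cl) : cl := cl_mul U V - cl_mul V U.

Definition cl_Tr (U : cl) : C := U finset.set0.

(** U has zero projection onto the center (span of e, and of e^{1...n} if n odd) *)
Definition in_cl_circ (U : cl) : Prop :=
  U finset.set0 = 0 /\ (odd n -> U (finset.setTfor 'I_n) = 0).

Definition hprod (h : 'I_n -> cl) (S : {set 'I_n}) : cl :=
  foldr cl_mul cl_e [seq h i | i <- enum S].

(** coordinates of U in the basis of h-forms (chosen classically; unique since
    the h-forms form a basis) *)
Definition hcoord (h : 'I_n -> cl) (U : cl) : {ffun {set 'I_n} -> C} :=
  xget 0 (fun c : {ffun {set 'I_n} -> C} =>
            U = \sum_(S : {set 'I_n}) cl_scale (c S) (hprod h S)).

Definition hproj (h : 'I_n -> cl) (k : nat) (U : cl) : cl :=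
  \sum_(S : {set 'I_n} | #|S| == k) cl_scale (hcoord h U S) (hprod h S).

Definition clifford_vector (h : 'I_n -> cl) : Prop :=
  (forall mu nu : 'I_n,
     cl_mul (h mu) (h nu) + cl_mul (h nu) (h mu) = cl_scale (2 * eta mu nu) cl_e)
  /\ cl_Tr (foldr cl_mul cl_e [seq h i | i <- enum 'I_n]) = 0.

Definition hlow (h : 'I_n -> cl) (rho : 'I_n) : cl :=
  \sum_(mu : 'I_n) cl_scale (eta rho mu) (h mu).

Definition unitv (mu : 'I_n) : 'rV[R]_n := delta_mx 0 mu.

Definition pd (mu : 'I_n) (g : 'rV[R]_n -> R) : 'rV[R]_n -> R :=
  fun x => 'D_(unitv mu) g x.

Fixpoint iter_pd (s : seq 'I_n) (g : 'rV[R]_n -> R) : 'rV[R]_n -> R :=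
  if s is mu :: s' then pd mu (iter_pd s' g) else g.

Definition smooth_real (g : 'rV[R]_n -> R) : Prop :=
  forall s : seq 'I_n,
    continuous (iter_pd s g) /\ forall (mu : 'I_n) x, derivable (iter_pd s g) x (unitv mu).

Definition smooth_cl (F : 'rV[R]_n -> cl) : Prop :=
  forall A : {set 'I_n},
    smooth_real (fun x => complex.Re (F x A)) /\ smooth_real (fun x => complex.Im (F x A)).

Definition pd_cl (mu : 'I_n) (F : 'rV[R]_n -> cl) : 'rV[R]_n -> cl :=
  fun x => [ffun A => Complex (pd mu (fun y => complex.Re (F y A)) x)
                              (pd mu (fun y => complex.Im (F y A)) x)].

Definition nprime : nat := if odd n then n.-1 else n.

Definition mu_coef (k : nat) : C :=
  (n%:R - (-1) ^+ k * (n%:R - (2 * k)%:R))^-1.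

End Clifford.

(* Main.v *)
Require Import Defs.
From HB Require Import structures.
From mathcomp Require Import all_boot all_order all_algebra.
From mathcomp Require Import all_classical all_reals all_analysis.
From mathcomp Require Import complex ring.
Import Order.TTheory GRing.Theory Num.Theory.
Import numFieldNormedType.Exports.
Local Open Scope ring_scope.

Set Implicit Arguments.
Unset Strict Implicit.
Unset Printing Implicit Defensive.

(** Write [h_S] for the ordered product of the [h^i], [i] in [S].  Up to a
    nonzero scalar depending only on [S] and [T], [h_S h_T] is [h_(S xor T)],
    and the trace of [h_S] vanishes for nonempty [S]; hence the [h_S] are linearly
    independent, and a basis by dimension.  The sum over [rho] of
    [h^rho X h_rho] multiplies the rank-[k] part of [X] by [(-1)^k (n - 2k)],
    so if [dh^rho = [B, h^rho]] for all [rho], then the rank-[k] part of the sum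
    of [(dh^rho) h_rho] is [n - (-1)^k (n - 2k)] times that of [B], and the
    right-hand side of (b) is [B] stripped of its central components.  With
    [B := C] this gives (a) => (b).  Conversely some such [B] always exists: the
    mean over [S] of [d(h_S) (h_S)^-1], by the averaging argument which shows
    that derivations of a group algebra are inner; (b) then says that [C] and
    [B] differ by a central element. *)

(** * Symmetric difference of finite sets *)

Section SymmetricDifference.
Variable I : finType.
Implicit Types (i : I) (S T U : {set I}).

Definition sdiff S T : {set I} := (S :\: T) :|: (T :\: S).

Lemma in_sdiff S T i : (i \in sdiff S T) = (i \in S) (+) (i \in T).
Proof. by rewrite !inE; case: (i \in S); case: (i \in T). Qed.

Lemma sdiffA : associative sdiff.
Proof. by move=> S T U; apply/setP=> i; rewrite !in_sdiff addbA. Qed.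

Lemma sdiffK S : involutive (sdiff S).
Proof. by move=> T; apply/setP=> i; rewrite !in_sdiff addbA addbb. Qed.

Lemma sdiff0s S : sdiff finset.set0 S = S.
Proof. by apply/setP=> i; rewrite in_sdiff inE. Qed.

Lemma sdiffs0 S : sdiff S finset.set0 = S.
Proof. by apply/setP=> i; rewrite in_sdiff inE addbF. Qed.

Lemma sdiffss S : sdiff S S = finset.set0.
Proof. by apply/setP=> i; rewrite in_sdiff inE addbb. Qed.

Lemma sdiff_eq0 S T : (sdiff S T == finset.set0) = (S == T).
Proof.
by apply/eqP/eqP=> [eq0|->]; rewrite ?sdiffss // -[T](sdiffK S) eq0 sdiffs0.
Qed.

End SymmetricDifference.

(** * Monomials in a Clifford family of an abstract algebra *)

Section CliffordFamily.
Variables (F : numFieldType) (A : algType F) (I : finType) (eps : I -> F).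
Hypothesis eps_neq0 : forall i, eps i != 0.
Implicit Types (i j : I) (S T : {set I}) (h : I -> A) (X : A).

Definition clifford_family h :=
  forall i j, h i * h j + h j * h i = (2 * (if i == j then eps i else 0)) *: 1.

Definition monomial h S : A := \prod_(i <- enum S) h i.

Lemma clifford_sqr h i : clifford_family h -> h i * h i = eps i *: 1.
Proof.
move=> /(_ i i); rewrite eqxx -mulr2n -scaler_nat -scalerA => /scalerI.
by apply; rewrite pnatr_eq0.
Qed.

Lemma clifford_anti h i j :
  clifford_family h -> i != j -> h i * h j = - (h j * h i).
Proof.
move=> /(_ i j) hij /negbTE ne; apply/eqP.
by rewrite -addr_eq0 hij ne mulr0 scale0r.
Qed.

(** Each factor other than [h i] costs one sign when [h i] crosses it; [h i] commutes with
    itself. *)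
Lemma gen_prod h i (s : seq I) : clifford_family h ->
  h i * \prod_(j <- s) h j
    = (-1) ^+ count (predC1 i) s *: (\prod_(j <- s) h j * h i).
Proof.
move=> hh; elim: s => [|j s IHs]; first by rewrite big_nil mulr1 mul1r scale1r.
rewrite big_cons /= exprD -scalerA -mulrA scalerAr -IHs !mulrA.
have [->|ne] /= := eqVneq j i; first by rewrite scale1r.
by rewrite (clifford_anti hh ne) scaleN1r mulNr opprK.
Qed.

Lemma gen_monomial h i S : clifford_family h ->
  h i * monomial h S = (-1) ^+ #|S :\ i| *: (monomial h S * h i).
Proof.
move=> hh; rewrite /monomial gen_prod //; congr (_ ^+ _ *: _).
rewrite -size_filter cardE; apply/perm_size/uniq_perm.
- exact/filter_uniq/enum_uniq.
- exact: enum_uniq.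
- by move=> j; rewrite mem_filter !mem_enum !inE.
Qed.

(* The scalar has to be chosen before the family: it is then constant along a
   field of Clifford families, and can be pulled out of a derivative. *)
Lemma gen_mul_monomial i S : exists2 c : F, c != 0 &
  forall h, clifford_family h ->
    h i * monomial h S = c *: monomial h (sdiff [set i] S).
Proof.
(* The enumeration is cut at [i]: [h i] must cross the factors indexed in [s1] to reach its
   place. *)
have [s1 [s2 s12]]: exists s1 s2, enum I = s1 ++ i :: s2.
  have /splitPr[s1 s2] : i \in enum I by rewrite mem_enum.
  by exists s1, s2.
have := enum_uniq I; rewrite s12 cat_uniq /= negb_or.
move=> /and3P[_ /andP[i1 _] /andP[i2 _]].
pose P s (T : {set I}) h := \prod_(j <- s | j \in T) h j.
have monoE T h : monomial h T =
    P s1 T h * (if i \in T then h i * P s2 T h else P s2 T h).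
  have -> : monomial h T = \prod_(j <- enum I | j \in T) h j.
    by rewrite -big_filter enumT.
  by rewrite s12 big_cat big_cons.
have PE s h : i \notin s -> P s (sdiff [set i] S) h = P s S h.
  move=> iNs; rewrite /P big_seq_cond [RHS]big_seq_cond; apply: eq_bigl => j.
  rewrite in_sdiff inE; case: eqP => [->|_]; first by rewrite (negbTE iNs).
  by rewrite addFb.
have Pcomm h : clifford_family h -> h i * P s1 S h =
    (-1) ^+ count (predC1 i) [seq j <- s1 | j \in S] *: (P s1 S h * h i).
  by move=> hh; rewrite /P -big_filter gen_prod.
(* The sign comes from crossing [s1]; if [i] is already in [S], [h i] then meets itself and squares
   to [eps i]. *)
exists ((-1) ^+ count (predC1 i) [seq j <- s1 | j \in S]
          * (if i \in S then eps i else 1)).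
  by rewrite mulf_neq0 ?signr_eq0 //; case: ifP; rewrite ?oner_eq0.
move=> h hh; rewrite !monoE !PE // in_sdiff set11 mulrA Pcomm //.
case: ifP => _ /=; last by rewrite mulr1 -scalerAl mulrA.
rewrite -scalerAl -mulrA [h i * (h i * _)]mulrA clifford_sqr //.
by rewrite -scalerAl mul1r -scalerAr scalerA.
Qed.

Lemma monomial0 h : monomial h finset.set0 = 1.
Proof. by rewrite /monomial enum_set0 big_nil. Qed.

Lemma monomialM T S : exists2 c : F, c != 0 &
  forall h, clifford_family h ->
    monomial h T * monomial h S = c *: monomial h (sdiff T S).
Proof.
(* The factors of [h_T] are absorbed one at a time; each toggles its index in the second set. *)
suff prodM (s : seq I) : uniq s -> exists2 c : F, c != 0 &
  forall h, clifford_family h -> \prod_(j <- s) h j * monomial h S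
    = c *: monomial h (sdiff [set j in s] S).
  by have := prodM _ (enum_uniq T); rewrite set_enum.
elim: s => [_|i s IHs /= /andP[iNs /IHs[c c0 cE]]].
  exists 1 => [|h _]; rewrite ?oner_eq0 // big_nil mul1r scale1r.
  by rewrite finset.set_nil sdiff0s.
have [c' c'0 c'E] := gen_mul_monomial i (sdiff [set j in s] S).
exists (c * c') => [|h hh]; first by rewrite mulf_neq0.
rewrite big_cons -mulrA cE // -scalerAr c'E // scalerA sdiffA.
congr (_ *: monomial h (sdiff _ _)); apply/setP=> j.
rewrite in_sdiff !inE; case: eqP => [->|//]; by rewrite (negbTE iNs).
Qed.

(** A monomial squares to a nonzero scalar, since [sdiff S S] is empty. *)
Lemma monomial_inv h S : clifford_family h ->
  exists X, monomial h S * X = 1 /\ X * monomial h S = 1.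
Proof.
move=> hh; have [c c0 /(_ h hh) cE] := monomialM S S.
exists (c^-1 *: monomial h S).
by rewrite -scalerAr -scalerAl cE sdiffss monomial0 scalerA mulVf ?scale1r.
Qed.

(* If [d] extends [D] to a derivation of the group generated by the
   [h i], the mean [B] of [d g * g^-1] over this group satisfies
   [h i * B * (h i)^-1 = B - D i * (h i)^-1]. *)
Lemma derivation_inner h (D : I -> A) (d : {set I} -> A) : clifford_family h ->
  (forall i S, exists c : F, [/\ c != 0,
      h i * monomial h S = c *: monomial h (sdiff [set i] S) &
      D i * monomial h S + h i * d S = c *: d (sdiff [set i] S)]) ->
  exists B, forall i, D i = B * h i - h i * B.
Proof.
move=> hh dE.
have /fin_all_exists[g gE] S := monomial_inv S hh.
pose N : F := #|{set I}|%:R.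
have N0 : N != 0.
  by rewrite pnatr_eq0 -lt0n; apply/card_gt0P; exists finset.set0.
pose B := N^-1 *: \sum_S d S * g S.
exists B => i.
have [gi hgi gih] : exists2 gi, h i * gi = 1 & gi * h i = 1.
  exists ((eps i)^-1 *: h i); rewrite -?scalerAr -?scalerAl clifford_sqr //;
    by rewrite scalerA mulVf ?scale1r.
have hB : h i * B * gi = B - D i * gi.
  rewrite /B -scalerAr -scalerAl mulr_sumr mulr_suml.
  (* Conjugation by [h i] sends the summand of [S] to that of [sdiff [set i] S], up to the
     correction [D i * gi]. *)
  rewrite [\sum_S d S * g S](reindex_inj (inv_inj (sdiffK [set i]))) /=.
  rewrite -[D i * gi]scale1r -(mulVf N0) -scalerA -scalerBr; congr (_ *: _).
  rewrite scaler_nat -sumr_const -sumrB; apply: eq_bigr => S _.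
  have [c [c0 cE /eqP]] := dE i S; rewrite eq_sym addrC -subr_eq => /eqP hd.
  have gE' : g (sdiff [set i] S) = c *: (g S * gi).
    rewrite -[LHS]mulr1 -hgi -[h i]mulr1 -(proj1 (gE S)) !mulrA.
    rewrite -[g _ * h i * _]mulrA cE -!scalerAr (proj2 (gE _)).
    by rewrite -!scalerAl mul1r.
  rewrite gE' mulrA -hd !mulrBl -!scalerAl -!scalerAr !mulrA.
  by rewrite -[D i * _ * _]mulrA (proj1 (gE S)) mulr1.
by rewrite -[h i * B]mulr1 -gih mulrA hB mulrBl -mulrA gih mulr1
  opprB addrC subrK.
Qed.

(** Moving [h i] across [h_S] gives the sign [- (-1) ^+ #|S|] for the [#|S|] indices inside [S] and
    [(-1) ^+ #|S|] for those outside. *)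
Lemma contraction_monomial h S : clifford_family h ->
  \sum_i (eps i)^-1 *: (h i * monomial h S * h i)
    = ((-1) ^+ #|S| * (#|I|%:R - (2 * #|S|)%:R)) *: monomial h S.
Proof.
move=> hh.
transitivity ((\sum_i (-1) ^+ #|S :\ i| : F) *: monomial h S).
  rewrite scaler_suml; apply: eq_bigr => i _.
  rewrite gen_monomial // -scalerAl -mulrA clifford_sqr // -scalerAr mulr1.
  by rewrite !scalerA mulrAC mulVf ?mul1r.
congr (_ *: _); rewrite (bigID [in S]) /=.
rewrite (eq_bigr (fun=> - (-1) ^+ #|S|)) => [|i iS]; last first.
  by rewrite (cardsD1 i S) iS exprS mulN1r opprK.
rewrite [X in _ + X](eq_bigr (fun=> (-1) ^+ #|S|)) => [|i iNS]; last first.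
  by rewrite (cardsD1 i S) (negbTE iNS).
have -> : #|I| = (#|S| + #|[pred i | i \notin S]|)%N by rewrite cardC.
rewrite !sumr_const.
by move: ((-1) ^+ #|S| : F) #|S| #|_| => s a b; ring.
Qed.

(** The terms [X * h i * h i] add up to [#|I|] copies of [X]; the terms [h i * X * h i] are
    contracted monomial by monomial. *)
Lemma contraction_commutator h X (c : {set I} -> F) : clifford_family h ->
  X = \sum_S c S *: monomial h S ->
  \sum_i (eps i)^-1 *: ((X * h i - h i * X) * h i)
    = \sum_(S : {set I}) (#|I|%:R - (-1) ^+ #|S| * (#|I|%:R - (2 * #|S|)%:R))
               *: (c S *: monomial h S).
Proof.
move=> hh XE; under eq_bigr do rewrite mulrBl scalerBr; rewrite sumrB.
under eq_bigr do
  rewrite -mulrA clifford_sqr // -scalerAr mulr1 scalerA mulVf // scale1r.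
have -> : \sum_i (eps i)^-1 *: (h i * X * h i) =
    \sum_S \sum_i (eps i)^-1 *: (h i * (c S *: monomial h S) * h i).
  rewrite exchange_big; apply: eq_bigr => i _.
  by rewrite {1}XE mulr_sumr mulr_suml scaler_sumr.
rewrite sumr_const {1}XE -sumrMnl -sumrB; apply: eq_bigr => S _.
rewrite scalerBl scaler_nat; congr (_ - _).
rewrite [RHS]scalerA mulrC -scalerA -contraction_monomial // scaler_sumr.
apply: eq_bigr => i _.
by rewrite -scalerAr -scalerAl !scalerA mulrC.
Qed.

(** * Linear independence of the monomials by means of a trace *)

Section Trace.
Variable tr : {linear A -> F^o}.
Hypothesis trC : forall X Y, tr (X * Y) = tr (Y * X).
Hypothesis tr1 : tr 1 = 1.
Variable h : I -> A.
Hypothesis hh : clifford_family h.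

(** The trace of [h i * X * Y * h i] is [eps i] times that of [X * Y] by cyclicity, and the opposite
    of this when [h i] is moved across [X] and [Y]. *)
Lemma tr_anticomm i X Y :
  h i * X = - (X * h i) -> h i * Y = Y * h i -> tr (X * Y) = 0.
Proof.
move=> hX hY.
have : tr (h i * X * Y * h i) = eps i *: tr (X * Y).
  by rewrite trC !mulrA clifford_sqr // -!scalerAl mul1r linearZ.
rewrite hX mulNr -[X * _ * Y]mulrA hY mulNr -!mulrA clifford_sqr //.
rewrite -!scalerAr mulr1 linearN linearZ /= => /eqP.
rewrite eq_sym -addr_eq0 -mulr2n -scaler_nat !scaler_eq0 pnatr_eq0 /=.
by rewrite (negbTE (eps_neq0 i)) => /eqP.
Qed.

(** The index must leave [#|S :\ i|] odd: take it inside [S] when [#|S|] is even and outside when it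
    is odd. This fails only for the empty set, and for the full set of odd size. *)
Lemma monomial_anticomm S : S != finset.set0 ->
  ~~ (odd #|I| && (S == finset.setT)) ->
  exists i, h i * monomial h S = - (monomial h S * h i).
Proof.
move=> S0 ST; have [i [iP]] : exists i, odd #|S :\ i|.
  case oddS: (odd #|S|); last first.
    have [i iS] := finset.set0Pn _ S0; exists i; move: oddS.
    by rewrite (cardsD1 i S) iS => /negbFE.
  have : S != finset.setT.
    apply: contraNneq ST => SE; rewrite SE eqxx andbT.
    by rewrite -cardsT -SE.
  rewrite -finset.subTset => /subsetPn[i _ iNS]; exists i; move: oddS.
  by rewrite (cardsD1 i S) (negbTE iNS).
by exists i; rewrite gen_monomial // -signr_odd iP scaleN1r.
Qed.

Hypothesis trT : tr (monomial h finset.setT) = 0.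

(** An anticommuting generator kills the trace; the full set of odd size has none and is covered by
    [trT]. *)
Lemma tr_monomial S : S != finset.set0 -> tr (monomial h S) = 0.
Proof.
move=> S0; case: (boolP (odd #|I| && (S == finset.setT))).
  by case/andP=> _ /eqP ->.
move=> /(monomial_anticomm S0)[i hi].
by rewrite -[monomial h S]mulr1 (tr_anticomm hi) // mulr1 mul1r.
Qed.

Lemma tr_monomial_sqr S : tr (monomial h S * monomial h S) != 0.
Proof.
have [c c0 ->//] := monomialM S S.
by rewrite sdiffss monomial0 linearZ /= tr1 /GRing.scale /= mulr1.
Qed.

(** Distinct monomials are orthogonal for the trace form: their product is a multiple of a nonempty
    monomial. *)
Lemma tr_coord X (c : {set I} -> F) T : X = \sum_S c S *: monomial h S ->
  tr (X * monomial h T) = c T * tr (monomial h T * monomial h T).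
Proof.
move=> ->; rewrite mulr_suml linear_sum (bigD1 T) //= big1 => [|S ne].
  by rewrite addr0 -scalerAl linearZ.
have [k _ kE] := monomialM S T.
by rewrite -scalerAl kE // !linearZ /= tr_monomial ?sdiff_eq0 // !scaler0.
Qed.

Lemma monomial_free (c : {set I} -> F) :
  \sum_S c S *: monomial h S = 0 -> forall S, c S = 0.
Proof.
move=> c0 S; have := tr_coord S (esym c0); rewrite mul0r linear0 => /esym/eqP.
by rewrite mulf_eq0 (negbTE (tr_monomial_sqr S)) orbF => /eqP.
Qed.

End Trace.

Lemma monomial_full_central h i : clifford_family h -> odd #|I| ->
  h i * monomial h finset.setT = monomial h finset.setT * h i.
Proof.
move=> hh; rewrite gen_monomial // -cardsT (cardsD1 i finset.setT) inE.
by rewrite add1n oddS -signr_odd => /negbTE ->; rewrite scale1r.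
Qed.

End CliffordFamily.

(** * Structure constants of the Clifford product *)

Section BasisCoefficients.
Variables (R : realType) (p q : nat).
Local Notation n := (p + q)%N.
Local Notation k := (@basis_coef R p q).
Implicit Types (A B E : {set 'I_n}).

(** Written as products over all indices, the sign and metric factors can be compared factor by
    factor. *)
Let sgn A B : R[i] := \prod_(ab : 'I_n * 'I_n)
  (if (ab.1 \in A) && (ab.2 \in B) && (ab.2 < ab.1)%N then -1 else 1).

Let met A B : R[i] := \prod_a (if a \in A :&: B then Defs.eta R a a else 1).

Let basis_coefE A B : k A B = sgn A B * met A B.
Proof.
rewrite /basis_coef /sgn /met -!big_mkcond /= -prodr_const; congr (_ * _).
by apply: eq_bigl => ab; rewrite inE.
Qed.

Let sgnDl A B E : sgn (sdiff A B) E = sgn A E * sgn B E.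
Proof.
rewrite -big_split; apply: eq_bigr => -[a b] _ /=; rewrite in_sdiff.
by case: (a \in A); case: (a \in B); case: (b \in E); case: (b < a)%N;
  rewrite ?mulrNN ?mulr1 ?mul1r.
Qed.

Let sgnDr A B E : sgn A (sdiff B E) = sgn A B * sgn A E.
Proof.
rewrite -big_split; apply: eq_bigr => -[a b] _ /=; rewrite in_sdiff.
by case: (a \in A); case: (b \in B); case: (b \in E); case: (b < a)%N;
  rewrite ?mulrNN ?mulr1 ?mul1r.
Qed.

(** This is associativity on basis elements. The sign is multiplicative in each argument, and the
    metric factors agree index by index. *)
Lemma basis_coef_cocycle A B E :
  k A B * k (sdiff A B) E = k B E * k A (sdiff B E).
Proof.
rewrite !basis_coefE sgnDl sgnDr.
have metE : met A B * met (sdiff A B) E = met B E * met A (sdiff B E).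
  rewrite -!big_split; apply: eq_bigr => a _ /=.
  rewrite !finset.in_setI !in_sdiff.
  by case: (a \in A); case: (a \in B); case: (a \in E); rewrite ?mulr1 ?mul1r.
rewrite mulrACA metE [RHS]mulrACA; congr (_ * _).
by rewrite mulrA mulrC.
Qed.

Lemma basis_coef0s A : k finset.set0 A = 1.
Proof.
rewrite basis_coefE /sgn /met !big1 ?mulr1 // => a _;
  by rewrite ?finset.set0I inE.
Qed.

Lemma basis_coefs0 A : k A finset.set0 = 1.
Proof.
rewrite basis_coefE /sgn /met !big1 ?mulr1 // => a _;
  by rewrite ?finset.setI0 inE ?andbF.
Qed.

Lemma eta_neq0 (a : 'I_n) : Defs.eta R a a != 0.
Proof. by rewrite /Defs.eta eqxx; case: ifP; rewrite ?oppr_eq0 oner_eq0. Qed.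

Lemma etaE (a b : 'I_n) : Defs.eta R a b = if a == b then Defs.eta R a a else 0.
Proof. by rewrite /Defs.eta eqxx; case: eqP. Qed.

Lemma etaV (a : 'I_n) : (Defs.eta R a a)^-1 = Defs.eta R a a.
Proof. by rewrite /Defs.eta eqxx; case: ifP; rewrite ?invrN ?invr1. Qed.

Lemma basis_coef_neq0 A B : k A B != 0.
Proof.
rewrite mulf_neq0 ?signr_eq0 //; apply/prodf_neq0 => a _; exact: eta_neq0.
Qed.

Lemma basis_coef_gen (a : 'I_n) : k [set a] [set a] = Defs.eta R a a.
Proof.
rewrite /basis_coef (_ : [set _ | _] = finset.set0) ?cards0 ?mul1r.
  by rewrite finset.setIid big_set1.
apply/setP=> -[b c]; rewrite !inE /=.
by apply/negbTE/negP => /andP[/andP[/eqP -> /eqP ->]]; rewrite ltnn.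
Qed.

Lemma basis_coef_gen_anti (a b : 'I_n) :
  a != b -> k [set a] [set b] = - k [set b] [set a].
Proof.
(* Distinct generators share no metric factor, and their only possible inversion is the pair
   [(c, d)]. *)
have kE (c d : 'I_n) : c != d ->
    k [set c] [set d] = if (d < c)%N then -1 else 1.
  move=> ne; rewrite /basis_coef big1 ?mulr1 => [|e].
    rewrite (_ : [set _ | _] = if (d < c)%N then [set (c, d)] else finset.set0).
      by case: ifP; rewrite ?cards1 ?cards0.
    apply/setP=> -[e f]; rewrite !inE /=; case: ifP => dc; rewrite !inE.
      rewrite xpair_eqE; apply/andP/andP => [[/andP[]]//|[/eqP -> /eqP ->]].
      by rewrite !eqxx.
    by apply/negbTE/negP => /andP[/andP[/eqP -> /eqP ->]]; rewrite dc.
  by rewrite !inE => /andP[/eqP -> /eqP cd]; rewrite cd eqxx in ne.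
move=> ne; rewrite !kE // 1?eq_sym //; move: ne; rewrite -val_eqE /=.
by case: ltngtP; rewrite ?opprK.
Qed.

End BasisCoefficients.

(** An alias of [cl] on which the ring and algebra structures are those of the Clifford product. *)
Definition clifford (R : realType) (p q : nat) : Type := cl R p q.

(** * The Clifford algebra as an associative algebra with a trace *)

Section CliffordAlgebra.
Variables (R : realType) (p q : nat).
Local Notation n := (p + q)%N.
Local Notation k := (@basis_coef R p q).
Local Notation Cl := (clifford R p q).
Implicit Types (A B E S : {set 'I_n}) (U V W : cl R p q).

HB.instance Definition _ :=
  GRing.Zmodule.copy Cl {ffun {set 'I_n} -> R[i]}.

Lemma cl_mulE U V E :
  cl_mul U V E = \sum_A U A * V (sdiff A E) * k A (sdiff A E).
Proof.
rewrite ffunE; apply: eq_bigr => A _; rewrite (big_pred1 (sdiff A E)) // => B.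
rewrite -[symdiff A B]/(sdiff A B) /=.
by apply/eqP/eqP => [<-|->]; rewrite sdiffK.
Qed.

Lemma cl_mulA : associative (@cl_mul R p q).
Proof.
move=> U V W; apply/ffunP => E; rewrite !cl_mulE.
under [RHS]eq_bigr do rewrite cl_mulE !mulr_suml.
rewrite exchange_big; apply: eq_bigr => A _ /=.
rewrite cl_mulE mulr_sumr mulr_suml.
(* On the left [B] indexes the factor from [V], on the right the product of the first two
   factors. *)
rewrite (reindex_inj (inv_inj (sdiffK A))) /=; apply: eq_bigr => B _.
have -> : sdiff (sdiff A B) (sdiff A E) = sdiff B E.
  by apply/setP => a; rewrite !in_sdiff addbACA addbb.
have := basis_coef_cocycle R A (sdiff A B) (sdiff B E); rewrite sdiffK.
have -> : sdiff (sdiff A B) (sdiff B E) = sdiff A E.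
  by apply/setP => a; rewrite !in_sdiff;
    case: (a \in B); case: (a \in A); case: (a \in E).
move=> coc; transitivity
  (U A * V (sdiff A B) * W (sdiff B E) * (k A (sdiff A B) * k B (sdiff B E))).
  by rewrite coc; ring.
by ring.
Qed.

Lemma cl_mul1l : left_id (cl_e R p q) (@cl_mul R p q).
Proof.
move=> U; apply/ffunP => E; rewrite cl_mulE (bigD1 finset.set0) //= big1.
  by rewrite ffunE eqxx mul1r sdiff0s basis_coef0s mulr1 addr0.
by move=> A /negbTE A0; rewrite ffunE A0 !mul0r.
Qed.

Lemma cl_mul1r : right_id (cl_e R p q) (@cl_mul R p q).
Proof.
move=> U; apply/ffunP => E; rewrite cl_mulE (bigD1 E) //= big1.
  by rewrite sdiffss ffunE eqxx mulr1 basis_coefs0 mulr1 addr0.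
by move=> A /negbTE A0; rewrite [cl_e _ _ _ _]ffunE sdiff_eq0 A0 mulr0 mul0r.
Qed.

Lemma cl_mulDl : left_distributive (@cl_mul R p q) +%R.
Proof.
move=> U V W; apply/ffunP => E; rewrite [RHS]ffunE !cl_mulE -big_split.
by apply: eq_bigr => A _; rewrite ffunE !mulrDl.
Qed.

Lemma cl_mulDr : right_distributive (@cl_mul R p q) +%R.
Proof.
move=> U V W; apply/ffunP => E; rewrite [RHS]ffunE !cl_mulE -big_split.
by apply: eq_bigr => A _; rewrite ffunE mulrDr mulrDl.
Qed.

Lemma cl_e_neq0 : cl_e R p q != 0 :> Cl.
Proof.
by apply/eqP => /ffunP/(_ finset.set0)/eqP; rewrite !ffunE eqxx oner_eq0.
Qed.

HB.instance Definition _ :=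
  GRing.Zmodule_isNzRing.Build Cl cl_mulA cl_mul1l cl_mul1r cl_mulDl cl_mulDr
    cl_e_neq0.

Lemma cl_scaleA (a b : R[i]) U : cl_scale a (cl_scale b U) = cl_scale (a * b) U.
Proof. by apply/ffunP => A; rewrite !ffunE mulrA. Qed.

Lemma cl_scale1 : left_id 1 (@cl_scale R p q).
Proof. by move=> U; apply/ffunP => A; rewrite !ffunE mul1r. Qed.

Lemma cl_scaleDr : right_distributive (@cl_scale R p q) +%R.
Proof. by move=> a U V; apply/ffunP => A; rewrite !ffunE mulrDr. Qed.

Lemma cl_scaleDl U : {morph (@cl_scale R p q)^~ U : a b / a + b}.
Proof. by move=> a b; apply/ffunP => A; rewrite !ffunE mulrDl. Qed.

HB.instance Definition _ :=
  GRing.Zmodule_isLmodule.Build R[i] Cl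
    cl_scaleA cl_scale1 cl_scaleDr cl_scaleDl.

Lemma cl_scaleAl (a : R[i]) U V :
  cl_scale a (cl_mul U V) = cl_mul (cl_scale a U) V.
Proof.
apply/ffunP => E; rewrite ffunE !cl_mulE mulr_sumr.
by apply: eq_bigr => A _; rewrite ffunE !mulrA.
Qed.

HB.instance Definition _ :=
  GRing.Lmodule_isLalgebra.Build R[i] Cl cl_scaleAl.

Lemma cl_scaleAr (a : R[i]) U V :
  cl_scale a (cl_mul U V) = cl_mul U (cl_scale a V).
Proof.
apply/ffunP => E; rewrite ffunE !cl_mulE mulr_sumr.
by apply: eq_bigr => A _; rewrite ffunE; ring.
Qed.

HB.instance Definition _ :=
  GRing.Lalgebra_isAlgebra.Build R[i] Cl cl_scaleAr.

Definition cl_trace (U : Cl) : (R[i])^o := cl_Tr U.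

Lemma cl_trace_is_linear : linear cl_trace.
Proof. by move=> a U V; rewrite /cl_trace /cl_Tr !ffunE. Qed.

HB.instance Definition _ :=
  GRing.isLinear.Build R[i] Cl (R[i])^o _ cl_trace cl_trace_is_linear.

Lemma cl_trace_mul (U V : Cl) : cl_trace (U * V) = \sum_A U A * V A * k A A.
Proof.
rewrite /cl_trace /cl_Tr cl_mulE; apply: eq_bigr => A _.
by rewrite sdiffs0.
Qed.

Lemma cl_traceC (U V : Cl) : cl_trace (U * V) = cl_trace (V * U).
Proof.
by rewrite !cl_trace_mul; apply: eq_bigr => A _; rewrite [U A * _]mulrC.
Qed.

Lemma cl_trace1 : cl_trace 1 = 1.
Proof. by rewrite /cl_trace /cl_Tr ffunE eqxx. Qed.

Lemma cl_basisM A B :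
  (cl_basis R A : Cl) * cl_basis R B
    = k A B *: (cl_basis R (sdiff A B) : Cl).
Proof.
apply/ffunP => E; rewrite cl_mulE !ffunE (bigD1 A) //= big1 => [|S /negbTE S0].
  rewrite !ffunE eqxx mul1r addr0 -{2 3}[E](sdiffK A).
  rewrite (inj_eq (inv_inj (sdiffK A))).
  by case: eqP => [->|_]; rewrite ?sdiffK ?mul0r ?mulr0 // mulrC.
by rewrite ffunE S0 !mul0r.
Qed.

Local Notation gen := (fun i => cl_gen R i : Cl).

Lemma cl_gen_family : clifford_family (fun i : 'I_n => Defs.eta R i i) gen.
Proof.
move=> i j; rewrite !cl_basisM; have [->|ne] := eqVneq i j.
  rewrite sdiffss basis_coef_gen -scalerDl mulrDl.
  by rewrite mul1r.
rewrite mulr0 scale0r basis_coef_gen_anti //.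
have -> : sdiff [set i] [set j] = sdiff [set j] [set i].
  by apply/setP=> a; rewrite !in_sdiff addbC.
by rewrite scaleNr addNr.
Qed.

Lemma monomial_gen S : exists2 c : R[i], c != 0 &
  monomial gen S = c *: (cl_basis R S : Cl).
Proof.
suff prodE (s : seq 'I_n) : uniq s -> exists2 c : R[i], c != 0 &
    \prod_(i <- s) gen i = c *: (cl_basis R [set i in s] : Cl).
  by have := prodE _ (enum_uniq S); rewrite set_enum.
elim: s => [_|i s IHs /= /andP[iNs /IHs[c c0 cE]]].
  by exists 1; rewrite ?oner_eq0 // big_nil scale1r finset.set_nil.
exists (c * k [set i] [set j in s]).
  by rewrite mulf_neq0 // basis_coef_neq0.
rewrite big_cons cE -scalerAr cl_basisM scalerA; congr (_ *: cl_basis R _).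
by apply/setP => j; rewrite in_sdiff !inE; case: eqP => // ->;
  rewrite (negbTE iNs).
Qed.

(* Pairing with a basis element that anticommutes with a generator kills a
   central element, and the coordinates are such pairings. *)
Lemma central_coord (X : Cl) S : (forall Y : Cl, X * Y = Y * X) ->
  S != finset.set0 -> ~~ (odd n && (S == finset.setT)) -> X S = 0.
Proof.
move=> XC S0 ST; have [i hi] : exists i, gen i * monomial gen S
    = - (monomial gen S * gen i).
  apply: (monomial_anticomm cl_gen_family) => //; by rewrite card_ord.
have := tr_anticomm (@eta_neq0 R p q) cl_traceC cl_gen_family hi
  (esym (XC (gen i))).
have [c c0 ->] := monomial_gen S.
rewrite -scalerAl linearZ /= cl_trace_mul (bigD1 S) //= big1 => [|A /negbTE A0].
  rewrite ffunE eqxx mul1r addr0 => /eqP.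
  by rewrite scaler_eq0 (negbTE c0) mulf_eq0
    (negbTE (basis_coef_neq0 _ _ _)) orbF => /eqP.
by rewrite ffunE A0 !mul0r.
Qed.

End CliffordAlgebra.

(** * Coordinates and projections in the basis of h-forms *)

Section HForms.
Variables (R : realType) (p q : nat).
Local Notation n := (p + q)%N.
Local Notation Cl := (clifford R p q).
Local Notation eps := (fun i : 'I_n => Defs.eta R i i).
Implicit Types (h : 'I_n -> Cl) (S : {set 'I_n}) (U : Cl).

Lemma hprodE h S : hprod h S = monomial h S :> Cl.
Proof.
rewrite /hprod /monomial; elim: (enum S) => [|i s IHs].
  by rewrite big_nil.
by rewrite big_cons /= IHs.
Qed.

Lemma clifford_vector_family h : clifford_vector h -> clifford_family eps h.
Proof. by case=> hh _ i j; rewrite -etaE; exact: hh. Qed.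

Lemma clifford_vector_trace h : clifford_vector h ->
  cl_trace (monomial h finset.setT) = 0.
Proof.
case=> _ trh; rewrite -hprodE; move: trh; rewrite /hprod /cl_trace.
by rewrite (eq_enum (A := finset.setT) (B := 'I_n)) // => i; rewrite !inE.
Qed.

(** The coordinates of the h-forms are the rows of a square matrix; freeness makes it invertible. *)
Lemma hform_span h U : clifford_vector h ->
  exists c : {ffun {set 'I_n} -> R[i]}, U = \sum_S c S *: monomial h S.
Proof.
move=> hv; have hh := clifford_vector_family hv.
pose M := \matrix_(i < #|{set 'I_n}|, j < #|{set 'I_n}|)
  (monomial h (enum_val i) (enum_val j) : R[i]).
have mulM (v : 'rV_#|{set 'I_n}|) A :
    (v *m M) 0 (enum_rank A)
      = (\sum_S v 0 (enum_rank S) *: monomial h S : Cl) A.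
  rewrite mxE sum_ffunE (reindex _ (onW_bij _ (@enum_rank_bij _))) /=.
  by apply: eq_bigr => S _; rewrite !mxE !enum_rankK ffunE.
have M_unit : M \in unitmx.
  rewrite -row_free_unit; apply: inj_row_free => v vM0; apply/rowP => j.
  rewrite mxE -(enum_valK j).
  apply: (monomial_free (@eta_neq0 R p q) (@cl_traceC R p q) (@cl_trace1 R p q)
    hh (clifford_vector_trace hv) (c := fun S => v 0 (enum_rank S))).
  by apply/ffunP => A; rewrite -mulM vM0 mxE ffunE.
pose u : 'rV_#|{set 'I_n}| := \row_j U (enum_val j).
exists [ffun S => (u *m invmx M) 0 (enum_rank S)].
under eq_bigr do rewrite ffunE.
by apply/ffunP => A; rewrite -mulM mulmxKV // mxE enum_rankK.
Qed.

(** Coordinates exist by [hform_span], so [xget] does not fall back on its default [0]. *)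
Lemma hcoordE h U : clifford_vector h ->
  U = \sum_S hcoord h U S *: monomial h S.
Proof.
move=> hv; have [c cE] := hform_span U hv; rewrite /hcoord.
case: xgetP => [_ -> {1}->|/(_ c)[]].
  by apply: eq_bigr => S _; rewrite hprodE.
by rewrite cE; apply: eq_bigr => S _; rewrite hprodE.
Qed.

Lemma hcoord_trace h U S : clifford_vector h ->
  cl_trace (U * monomial h S)
    = hcoord h U S * cl_trace (monomial h S * monomial h S).
Proof.
move=> hv; exact: (tr_coord (@eta_neq0 R p q) (@cl_traceC R p q)
  (clifford_vector_family hv) (clifford_vector_trace hv) S (hcoordE U hv)).
Qed.

Lemma hcoord_unique h U (c : {set 'I_n} -> R[i]) S : clifford_vector h ->
  U = \sum_S c S *: monomial h S -> hcoord h U S = c S.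
Proof.
move=> hv UE; have hh := clifford_vector_family hv.
have nz := tr_monomial_sqr (@eta_neq0 R p q) (@cl_trace1 R p q) hh S.
apply: (mulIf nz); rewrite -hcoord_trace //.
exact: (tr_coord (@eta_neq0 R p q) (@cl_traceC R p q) hh
  (clifford_vector_trace hv) S UE).
Qed.

Lemma hcoord0_trace h U S : clifford_vector h ->
  cl_trace (U * monomial h S) = 0 -> hcoord h U S = 0.
Proof.
move=> hv; rewrite hcoord_trace // => /eqP; rewrite mulf_eq0.
have hh := clifford_vector_family hv.
by rewrite (negbTE (tr_monomial_sqr (@eta_neq0 R p q) (@cl_trace1 R p q) hh S))
  orbF => /eqP.
Qed.

(** The full h-form commutes with each [h i], hence with every h-form, and these span. *)
Lemma hform_full_central h U : clifford_vector h -> odd n ->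
  monomial h finset.setT * U = U * monomial h finset.setT.
Proof.
move=> hv on; have hh := clifford_vector_family hv.
rewrite (hcoordE U hv) mulr_sumr mulr_suml; apply: eq_bigr => S _.
rewrite -scalerAr -scalerAl; congr (_ *: _); rewrite /(monomial h S).
elim: (enum S) => [|i s IHs]; first by rewrite big_nil mulr1 mul1r.
rewrite big_cons mulrA -(monomial_full_central i hh) ?card_ord //.
by rewrite -!mulrA IHs.
Qed.

Definition noncentral S :=
  (S != finset.set0) && ~~ (odd n && (S == finset.setT)).

(** Transfers a vanishing central part from the fixed basis to the h-forms. For odd [n] the full
    h-form is central, so it lives on the empty and full coordinates, where [U] vanishes. *)
Lemma hcoord_circ h U S : clifford_vector h -> in_cl_circ U ->
  ~~ noncentral S -> hcoord h U S = 0.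
Proof.
move=> hv [U0 UT]; rewrite negb_and !negbK => /orP[/eqP->|/andP[on /eqP->]];
  apply: hcoord0_trace => //; first by rewrite monomial0 mulr1.
rewrite cl_trace_mul big1 // => A _.
have [->|A0] := eqVneq A finset.set0; first by rewrite U0 !mul0r.
have [->|AT] := eqVneq A finset.setT; first by rewrite UT // !mul0r.
rewrite (central_coord (X := monomial h finset.setT)) ?mulr0 ?mul0r //.
  by move=> Y; exact: hform_full_central.
by rewrite (negbTE AT) andbF.
Qed.

Lemma comm_noncentral h U i : clifford_vector h ->
  let V := \sum_(S | noncentral S) hcoord h U S *: monomial h S in
  V * h i - h i * V = U * h i - h i * U.
Proof.
move=> hv V.
have -> : U = V + \sum_(S | ~~ noncentral S) hcoord h U S *: monomial h S.
  by rewrite {1}(hcoordE U hv) (bigID noncentral).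
rewrite mulrDl mulrDr opprD addrACA -[LHS]addr0; congr (_ + _); apply/esym/eqP.
rewrite subr_eq0 mulr_suml mulr_sumr; apply/eqP; apply: eq_bigr => S.
rewrite negb_and !negbK -scalerAl -scalerAr => /orP[/eqP->|/andP[on /eqP->]].
  by rewrite monomial0 mulr1 mul1r.
by rewrite hform_full_central.
Qed.

(** Matches the range of ranks in (b) with index sets: for odd [n], lowering the bound to [n.-1]
    removes exactly the full set. *)
Lemma noncentral_card S : noncentral S = (0 < #|S| < (nprime p q).+1)%N.
Proof.
rewrite /noncentral -card_gt0 ltnS /nprime; congr (_ && _).
have le : (#|S| <= n)%N by rewrite -[X in (_ <= X)%N]card_ord max_card.
have -> : (S == finset.setT) = (#|S| == n)%N.
  by rewrite eqEcard finset.subsetT cardsT card_ord eqn_leq le.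
case: ifP => on /=; last by rewrite le.
move: #|S| on le => c; move: (p + q)%N => [|m] //= _.
by rewrite -[RHS]ltnS [RHS]ltn_neqAle => ->; rewrite andbT.
Qed.

(** With [k] for [#|S|], the denominator is [2k] for even [k] and [2(n - k)] for odd [k]; it could
    vanish only at [k = 0] or at [k = n] odd, both excluded. *)
Lemma mu_coefV S : noncentral S ->
  mu_coef R p q #|S| * (n%:R - (-1) ^+ #|S| * (n%:R - (2 * #|S|)%:R)) = 1.
Proof.
rewrite noncentral_card ltnS /nprime => /andP[S0 Sn]; rewrite mulVf //.
rewrite -signr_odd; case oS: (odd #|S|); last first.
  by rewrite mul1r opprB addrC subrK pnatr_eq0 muln_eq0 -lt0n.
rewrite mulN1r opprK addrA -natrD subr_eq0 eqr_nat addnn -mul2n eqn_pmul2l //.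
apply/eqP => nS; rewrite -nS in oS S0 Sn; rewrite oS in Sn.
by rewrite -ltnS prednK // ltnn in Sn.
Qed.

Lemma hlowE h i : hlow h i = Defs.eta R i i *: h i.
Proof.
rewrite /hlow (bigD1 i) //= big1 ?addr0 // => j /negbTE ne.
by rewrite etaE eq_sym ne; exact: (scale0r (h j)).
Qed.

(** Evaluates the right-hand side of (b) for any [B] implementing the derivative as a commutator:
    the contraction scales rank [k] by the inverse of [mu_coef R p q k]. *)
Lemma contraction_formula h (D : 'I_n -> Cl) (B : Cl) : clifford_vector h ->
  (forall i, D i = B * h i - h i * B) ->
  \sum_(1 <= k < (nprime p q).+1)
     cl_scale (mu_coef R p q k) (hproj h k (\sum_i cl_mul (D i) (hlow h i)))
  = \sum_(S | noncentral S) hcoord h B S *: monomial h S.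
Proof.
move=> hv DE; have hh := clifford_vector_family hv.
pose lambda S : R[i] := n%:R - (-1) ^+ #|S| * (n%:R - (2 * #|S|)%:R).
have contr : \sum_i cl_mul (D i) (hlow h i)
    = \sum_S (lambda S * hcoord h B S) *: monomial h S.
  have := contraction_commutator (@eta_neq0 R p q) hh (hcoordE B hv).
  under [RHS]eq_bigr do rewrite scalerA card_ord.
  move=> <-; apply: eq_bigr => i _.
  rewrite hlowE etaV DE; exact: (esym
    (scalerAr (Defs.eta R i i) (B * h i - h i * B) (h i))).
(* The condition [noncentral S] becomes a sum over ranks with the single term [k = #|S|]; exchanging
   the sums groups the h-forms by rank. *)
rewrite [RHS]big_mkcond; under [RHS]eq_bigr => S _.
  rewrite noncentral_card.
  rewrite -(big_nat1_eq +%R (fun=> hcoord h B S *: monomial h S)).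
  over.
rewrite (exchange_big_dep xpredT) //=; apply: eq_big_nat => k kn.
rewrite /hproj; transitivity (mu_coef R p q k *:
    \sum_(S : {set 'I_n} | #|S| == k)
       (lambda S * hcoord h B S) *: monomial h S).
  congr (cl_scale _ _); apply: eq_bigr => S _.
  by rewrite (hcoord_unique S hv contr) hprodE.
rewrite scaler_sumr; apply: eq_big => [S|S /eqP Sk]; first by rewrite eq_sym.
by rewrite !scalerA mulrA -Sk mu_coefV ?mul1r // noncentral_card Sk.
Qed.

End HForms.

(** * Directional derivatives of complex-valued functions *)

Section ComplexDerivative.
Variables (R : realType) (V : normedModType R) (x v : V).
Implicit Types (f g : V -> R[i]) (a b : R[i]).

(** Real and imaginary parts are differentiated separately, as in [pd_cl]. *)
Definition is_derivec f a :=
  is_derive x v (fun y => complex.Re (f y)) (complex.Re a) /\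
  is_derive x v (fun y => complex.Im (f y)) (complex.Im a).

Let ReD a b : complex.Re (a + b) = complex.Re a + complex.Re b.
Proof. by case: a; case: b. Qed.

Let ImD a b : complex.Im (a + b) = complex.Im a + complex.Im b.
Proof. by case: a; case: b. Qed.

Let ReM a b : complex.Re (a * b)
  = complex.Re a * complex.Re b - complex.Im a * complex.Im b.
Proof. by case: a; case: b. Qed.

Let ImM a b : complex.Im (a * b)
  = complex.Re a * complex.Im b + complex.Im a * complex.Re b.
Proof. by case: a; case: b. Qed.

Lemma is_derivec_cst a : is_derivec (fun=> a) 0.
Proof. by split; exact: is_derive_cst. Qed.

Lemma is_derivecD f g a b : is_derivec f a -> is_derivec g b ->
  is_derivec (fun y => f y + g y) (a + b).
Proof.
move=> [fr fi] [gr gi]; split.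
  rewrite (_ : (fun y => _)
    = (fun y => complex.Re (f y)) + (fun y => complex.Re (g y))).
    by rewrite ?ReD ?ImD; exact: is_deriveD.
  by apply/funext => y; rewrite ?ReD ?ImD.
rewrite (_ : (fun y => _)
    = (fun y => complex.Im (f y)) + (fun y => complex.Im (g y))).
  by rewrite ?ReD ?ImD; exact: is_deriveD.
by apply/funext => y; rewrite ?ReD ?ImD.
Qed.

Lemma is_derivecM f g a b : is_derivec f a -> is_derivec g b ->
  is_derivec (fun y => f y * g y) (a * g x + f x * b).
Proof.
have scaleE (r s : R) : r *: (s : R^o) = r * s by [].
move=> [fr fi] [gr gi]; split.
  rewrite (_ : (fun y => _)
     = (fun y => complex.Re (f y)) * (fun y => complex.Re (g y))
     - (fun y => complex.Im (f y)) * (fun y => complex.Im (g y))).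
    by apply: is_derive_eq; rewrite ReD !ReM !scaleE; ring.
  by apply/funext => y; rewrite ReM.
rewrite (_ : (fun y => _)
     = (fun y => complex.Re (f y)) * (fun y => complex.Im (g y))
     + (fun y => complex.Im (f y)) * (fun y => complex.Re (g y))).
  by apply: is_derive_eq; rewrite ImD !ImM !scaleE; ring.
by apply/funext => y; rewrite ImM.
Qed.

Lemma is_derivec_sum (I : Type) (r : seq I) (f : I -> V -> R[i])
    (a : I -> R[i]) :
  (forall i, is_derivec (f i) (a i)) ->
  is_derivec (fun y => \sum_(i <- r) f i y) (\sum_(i <- r) a i).
Proof.
move=> fa; elim: r => [|i r IHr].
  under eq_fun do rewrite big_nil; rewrite big_nil; exact: is_derivec_cst.
under eq_fun do rewrite big_cons; rewrite big_cons; exact: is_derivecD.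
Qed.

End ComplexDerivative.

(** * Directional derivatives of Clifford-valued functions *)

Section CliffordDerivative.
Variables (R : realType) (p q : nat).
Local Notation n := (p + q)%N.
Local Notation Cl := (clifford R p q).
Variables (x v : 'rV[R]_n).
Implicit Types (F G : 'rV[R]_n -> Cl) (D E : Cl).

Definition is_derive_cl F D :=
  forall A, is_derivec x v (fun y => F y A) (D A).

Lemma is_derive_cl_cst D : is_derive_cl (fun=> D) 0.
Proof. by move=> A; rewrite ffunE; exact: is_derivec_cst. Qed.

Lemma is_derive_clM F G D E : is_derive_cl F D -> is_derive_cl G E ->
  is_derive_cl (fun y => F y * G y) (D * G x + F x * E).
Proof.
move=> FD GE A; under eq_fun do rewrite cl_mulE.
rewrite ffunE !cl_mulE -big_split /=.
apply: is_derivec_sum => B.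
(* The structure constant is treated as a constant function; the added zero gives the shape of the
   product rule. *)
rewrite -mulrDl -[X in is_derivec _ _ _ X]addr0.
rewrite -[X in _ + X](mulr0 (F x B * G x (sdiff B A))).
apply: (@is_derivecM _ _ _ _ (fun y => F y B * G y (sdiff B A)) (fun=> _)).
  exact: (@is_derivecM _ _ _ _ (fun y => F y B) (fun y => G y (sdiff B A))).
exact: is_derivec_cst.
Qed.

Lemma is_derive_clZ (c : R[i]) F D :
  is_derive_cl F D -> is_derive_cl (fun y => c *: F y) (c *: D).
Proof.
move=> FD; have := is_derive_clM (is_derive_cl_cst (c%:A)) FD.
rewrite mul0r add0r mulr_algl.
by under eq_fun do rewrite mulr_algl.
Qed.

Lemma is_derive_cl_unique F D E :
  is_derive_cl F D -> is_derive_cl F E -> D = E.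
Proof.
move=> FD FE; apply/ffunP => A; have [Dr Di] := FD A; have [Er Ei] := FE A.
apply/eqP; rewrite eq_complex.
rewrite -(@derive_val _ _ _ _ _ _ _ Dr) -(@derive_val _ _ _ _ _ _ _ Di).
by rewrite (@derive_val _ _ _ _ _ _ _ Er) (@derive_val _ _ _ _ _ _ _ Ei) !eqxx.
Qed.

Lemma is_derive_cl_monomial (h : 'I_n -> 'rV[R]_n -> Cl) (S : {set 'I_n}) :
  (forall i, exists D, is_derive_cl (h i) D) ->
  exists D, is_derive_cl (fun y => monomial (h^~ y) S) D.
Proof.
move=> hD; rewrite /monomial; elim: (enum S) => [|i s [E sE]].
  by exists 0; under eq_fun do rewrite big_nil; exact: is_derive_cl_cst.
have [D iD] := hD i; exists (D * \prod_(j <- s) h j x + h i x * E).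
by under eq_fun do rewrite big_cons; exact: is_derive_clM.
Qed.

End CliffordDerivative.

(** * Commutator form of the derivative of a Clifford field, and the equivalence *)

Lemma smooth_is_derive_cl (R : realType) (p q : nat)
    (F : 'rV[R]_(p + q) -> clifford R p q) mu x :
  smooth_cl F -> is_derive_cl x (unitv R mu) F (pd_cl mu F x).
Proof.
move=> sF A; rewrite ffunE; have [sr si] := sF A.
by split; apply: derivableP; [have [_] := sr [::]|have [_] := si [::]]; apply.
Qed.

Lemma clifford_field_inner (R : realType) (p q : nat)
    (h : 'I_(p + q) -> 'rV[R]_(p + q) -> clifford R p q)
    (D : 'I_(p + q) -> clifford R p q) (x v : 'rV[R]_(p + q)) :
  (forall y, clifford_vector (fun nu => h nu y)) ->
  (forall i, is_derive_cl x v (h i) (D i)) ->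
  exists B : clifford R p q, forall i, D i = B * h i x - h i x * B.
Proof.
move=> hv hD.
have [d dE] : exists d : {set 'I_(p + q)} -> clifford R p q, forall S,
    is_derive_cl x v (fun y => monomial (h^~ y) S) (d S).
  have /fin_all_exists[d dE] S := @is_derive_cl_monomial _ _ _ x v h S
    (fun i => ex_intro _ (D i) (hD i)).
  by exists d.
apply: (@derivation_inner _ _ _ (fun i => Defs.eta R i i) (@eta_neq0 R p q)
  (h^~ x) D d); first exact: clifford_vector_family.
move=> i S.
have [c c0 cE] := gen_mul_monomial (clifford R p q) (@eta_neq0 R p q) i S.
exists c; split=> //; first exact/cE/clifford_vector_family.
(* As [c] is the same at all points, both sides of [h i * h_S = c *: h_(sdiff [set i] S)] can be
   differentiated; the two derivatives agree. *)
apply: is_derive_cl_unique (is_derive_clZ c (dE (sdiff [set i] S))).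
rewrite [F in is_derive_cl _ _ F](_ : _ = fun y => h i y * monomial (h^~ y) S).
  exact: is_derive_clM.
by apply/funext => y; rewrite cE //; exact: clifford_vector_family.
Qed.

Theorem theorem8 (R : realType) (p q : nat)
  (h : 'I_(p + q) -> 'rV[R]_(p + q) -> cl R p q)
  (C : 'I_(p + q) -> 'rV[R]_(p + q) -> cl R p q) :
  (forall x, clifford_vector (fun mu => h mu x)) ->
  (forall mu, smooth_cl (h mu)) ->
  (forall mu, smooth_cl (C mu)) ->
  (forall mu x, in_cl_circ (C mu x)) ->
  ((forall (mu rho : 'I_(p + q)) x,
      pd_cl mu (fun y => hlow (fun nu => h nu y) rho) x
      - cl_comm (C mu x) (hlow (fun nu => h nu x) rho) = 0)
   <->
   (forall (mu : 'I_(p + q)) x,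
      C mu x =
      \sum_(1 <= k < (nprime p q).+1)
        cl_scale (mu_coef R p q k)
          (hproj (fun nu => h nu x) k
             (\sum_(rho : 'I_(p + q))
                 cl_mul (pd_cl mu (h rho) x) (hlow (fun nu => h nu x) rho))))).
Proof.
move=> hv hs _ Cc.
have hD mu x rho := smooth_is_derive_cl mu x (hs rho).
have pd_hlow mu rho x : pd_cl mu (fun y => hlow (fun nu => h nu y) rho) x
    = Defs.eta R rho rho *: (pd_cl mu (h rho) x : clifford R p q).
  have lD := is_derive_clZ (Defs.eta R rho rho) (hD mu x rho).
  apply/ffunP => A; have [lr li] := lD A.
  have hl y : hlow (fun nu => h nu y) rho A
      = (Defs.eta R rho rho *: (h rho y : clifford R p q)) A.
    by rewrite (hlowE (fun nu => h nu y)).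
  rewrite ffunE /pd; apply/eqP; rewrite eq_complex /=.
  under eq_fun do rewrite hl.
  under [X in _ && (derive X _ _ == _)]eq_fun do rewrite hl.
  rewrite (@derive_val _ _ _ _ _ _ _ lr) (@derive_val _ _ _ _ _ _ _ li).
  by rewrite !eqxx.
(* Lowering the index multiplies (a) by the nonzero constant [eta rho rho], which cancels. *)
have aE mu rho x : (pd_cl mu (fun y => hlow (fun nu => h nu y) rho) x
      - cl_comm (C mu x) (hlow (fun nu => h nu x) rho) = 0) <->
    pd_cl mu (h rho) x
      = (C mu x : clifford R p q) * h rho x
        - (h rho x : clifford R p q) * C mu x.
  rewrite pd_hlow (hlowE (fun nu => h nu x)).
  have -> : cl_comm (C mu x) (Defs.eta R rho rho *: (h rho x : clifford R p q))
    = Defs.eta R rho rho *: ((C mu x : clifford R p q) * h rho x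
         - (h rho x : clifford R p q) * C mu x).
    by rewrite scalerBr scalerAr scalerAl.
  split=> [|->]; last exact: subrr.
  by move/(@subr0_eq (clifford R p q))/(scalerI (eta_neq0 R rho)).
split=> [a mu x|b mu rho x].
  (* By (a), [C mu x] itself serves as [B]; having no central coordinates, it equals its noncentral
     part. *)
  rewrite (contraction_formula (B := C mu x) (hv x)) => [|i]; last exact/aE.
  rewrite {1}(hcoordE (C mu x) (hv x)) (bigID (@noncentral p q)) /=.
  rewrite [X in _ + X]big1 ?addr0 // => S Sc.
  by rewrite (hcoord_circ (hv x)) ?scale0r.
(* By (b), [C mu x] is the noncentral part of this [B], so it has the same commutators with the
   [h i]. *)
apply/aE; have [B BE] := clifford_field_inner hv (hD mu x).
by rewrite b (contraction_formula (hv x) BE) (comm_noncentral _ _ (hv x)).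
Qed.
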